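(* Let $p$ be a prime number and $R\cong\mathbb Z_p\times\mathbb Z_p\times\mathbb Z_p$. Put $$\lambda_{1,2} = \tfrac12\big(1-p\pm(p-1)\sqrt{4p-3}\big),\qquad \lambda_{3,4} = p-1\pm\sqrt{p-2p^2+p^3}.$$ Then the spectrum (multiset of eigenvalues) of the zero-divisor graph $\Gamma(R)$ is $$\operatorname{spec}(\Gamma(R)) = \big\{\lambda_1^{[2]},\lambda_2^{[2]},\lambda_3^{[1]},\lambda_4^{[1]},0^{[3(p+1)(p-2)]}\big\}.$$
   Context: $\mathbb Z_p$ denotes the ring of integers modulo $p$. For a finite commutative ring $R$ with $1\ne0$, the zero-divisor graph $\Gamma(R)$ has as vertex set the set of non-zero zero-divisors of $R$, and two (not necessarily distinct) vertices $x,y$ are adjacent iff $xy=0$ (loops are kept). The spectrum of a graph is the multiset of eigenvalues of its adjacency matrix; $\lambda^{[m]}$ means that $\lambda$ occurs with multiplicity $m$ (and $0^{[0]}$ means that $0$ does not occur). *)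

(* Defs.v *)
From HB Require Import structures.
From mathcomp Require Import all_boot all_order all_algebra.

Set Implicit Arguments.
Unset Strict Implicit.
Unset Printing Implicit Defensive.

Import GRing.Theory.
Local Open Scope ring_scope.

Definition ring_isomorphic (R S : nzRingType) : Prop :=
  exists f : {rmorphism R -> S}, bijective f.

Section ZeroDivisorGraph.
Variable R : finComNzRingType.

Definition zero_divisor (x : R) : bool :=
  [exists y : R, (y != 0) && (x * y == 0)].

Definition zd_vertex : finType := {x : R | (x != 0) && zero_divisor x}.

(* No condition x != y: a vertex with x * x = 0 carries a loop. *)
Definition zd_adj : rel zd_vertex := fun x y => val x * val y == 0.
End ZeroDivisorGraph.

(* The vertices are listed in the order of enum T; reordering them conjugates
   the matrix by a permutation matrix. A loop contributes a diagonal entry 1. *)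
Definition adjacency_mx (C : nzRingType) (T : finType) (e : rel T) :
  'M[C]_#|T| := \matrix_(i, j) (e (enum_val i) (enum_val j))%:R.

(* Eigenvalues repeated according to their multiplicity as roots of the
   characteristic polynomial; the order in the list is immaterial, so spectra
   are to be compared by perm_eq. *)
Definition mx_spectrum (C : closedFieldType) (n : nat) (A : 'M[C]_n) : seq C :=
  sval (closed_field_poly_normal (char_poly A)).

Definition graph_spectrum (C : closedFieldType) (T : finType) (e : rel T) :
  seq C := mx_spectrum (adjacency_mx C e).

(* Main.v *)
Require Import Defs.
From HB Require Import structures.
From mathcomp Require Import all_boot all_order all_algebra.
From mathcomp Require Import ring zify.
Import Order.TTheory GRing.Theory Num.Theory.
Local Open Scope ring_scope.

(**
Writing F for 'F_p, a vertex of the graph is determined up to twins by its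
support S, a nonempty proper subset of 'I_3, and two vertices are adjacent iff
their supports are disjoint.  The adjacency matrix therefore factors as U *m V
through the six supports, and has up to powers of 'X the same characteristic
polynomial as the 6 x 6 matrix V *m U.  With q = p - 1 there are q ^ #|S|
vertices of support S, so that, listing the singletons before their
complements, V *m U = [ q(J - 1), q^2 ; q, 0 ].  Eliminating the scalar blocks
gives
  \det ((X^2 + qX - q^3) - qX J) = (X^2 + qX - q^3)^2 (X^2 - 2qX - q^3),
whose roots are the four nonzero eigenvalues.
*)

(** * Characteristic polynomials of products and block matrices *)

Lemma char_poly_mulmxC (K : comNzRingType) m n (U : 'M[K]_(m, n))
    (V : 'M[K]_(n, m)) :
  'X^n * char_poly (U *m V) = 'X^m * char_poly (V *m U).
Proof.
pose u := map_mx polyC U; pose v := map_mx polyC V.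
(* Column operations clearing [v] give [\det M = char_poly (U *m V)]. Row operations clearing [v],
   after scaling the lower rows by ['X], give the right-hand side at the cost of a factor ['X^n]. *)
pose M : 'M_(m + n) := block_mx 'X%:M u v 1%:M.
have -> : char_poly (U *m V) = \det M.
  have <- : \det (M *m block_mx 1%:M 0 (- v) 1%:M) = \det M.
    by rewrite det_mulmx det_lblock !det1 !mulr1.
  rewrite mulmx_block !mulmx1 !mul1mx !mulmx0 addrN !add0r mulmxN det_ublock.
  by rewrite det1 mulr1 -map_mxM.
rewrite -(det_scalar n) -[\det 'X%:M]mul1r -(det1 _ m).
rewrite -(det_lblock _ (- v)) -det_mulmx mulmx_block !mul1mx !mul0mx !addr0.
rewrite mulmx1 mulNmx scalar_mxC addNr mulNmx addrC det_ublock det_scalar.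
by rewrite -map_mxM.
Qed.

(** Multiplying the characteristic matrix on the right by [ X, 0 ; c, 1 ] clears its lower left
    block. This multiplier and the remaining lower right block both have determinant ['X^n], which
    cancels over an integral domain. *)
Lemma char_poly_block_scalar (K : idomainType) n (A : 'M[K]_n) (b c : K) :
  char_poly (block_mx A b%:M c%:M 0)
  = \det ('X *: ('X%:M - map_mx polyC A) - (b * c)%:P%:M).
Proof.
have /mulIf := monic_neq0 (monicXn K n); apply.
rewrite /char_poly /char_poly_mx map_block_mx !map_scalar_mx map_mx0.
rewrite (scalar_mx_block n n) opp_block_mx add_block_mx subr0 !add0r.
set D := 'X%:M - _.
have XnE : 'X^n = \det (block_mx 'X%:M 0 c%:P%:M 1%:M : 'M[{poly K}]_(n + n)).
  by rewrite det_lblock det_scalar det1 mulr1.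
rewrite [in LHS]XnE -det_mulmx mulmx_block !mulmx0 !mulmx1 !add0r !mulNmx.
rewrite [_%:M *m 'X%:M]scalar_mxC addNr.
rewrite det_ublock det_scalar -scalar_mxM -polyCM.
by rewrite [D *m _]scalar_mxC mul_scalar_mx.
Qed.

(** Reflects the eigenvalues 3, 0, 0 of the all-ones matrix. *)
Lemma det_scalarBconst3 (K : comNzRingType) (a b : K) :
  \det (a%:M - const_mx b : 'M_3) = a ^+ 2 * (a - 3 * b).
Proof.
rewrite (expand_det_row _ ord0) !big_ord_recl big_ord0 /cofactor.
rewrite !(expand_det_row _ ord0) !big_ord_recl !big_ord0 /cofactor !det_mx11.
rewrite !mxE /=.
ring.
Qed.

(** [mx_spectrum] is a chosen factorization into linear factors, and such a factorization of a monic
    polynomial is unique up to order. *)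
Lemma perm_mx_spectrum (C : closedFieldType) n (A : 'M[C]_n) (s : seq C) :
  char_poly A = \prod_(x <- s) ('X - x%:P) -> perm_eq (mx_spectrum A) s.
Proof.
move=> As; apply: prod_XsubC_eq; rewrite -As /mx_spectrum.
case: closed_field_poly_normal => r /= Ar.
by rewrite [RHS]Ar (monicP (char_poly_monic A)) scale1r.
Qed.

(** A subset of size 2 is the complement of a singleton, so ['I_3] can index both kinds of
    support. *)
Lemma proper_set_ord3 (S : {set 'I_3}) :
  S != set0 -> S != setT -> (exists i, S = [set i]) \/ (exists i, S = [set~ i]).
Proof.
rewrite -card_gt0 eqEcard subsetT cardsT card_ord -ltnNge /= => S0 S3.
have [|S1] := leqP #|S| 1.
  by move=> S1; left; apply/cards1P; rewrite eqn_leq S1.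
right; have /cards1P[i Si] : #|~: S| == 1%N.
  have S2 : #|S| = 2%N by apply/eqP; rewrite eqn_leq S1 andbT.
  by rewrite -(eqn_add2l #|S|) cardsC S2 card_ord.
by exists i; rewrite -Si setCK.
Qed.

(** * Supports and their vertex counts *)

Section ProductOfThreeCopies.
Variables (F : finFieldType) (R : finComNzRingType).
Variable coord : R -> {ffun 'I_3 -> F}.
Hypothesis coord_bij : bijective coord.
Hypothesis coord0 : coord 0 = [ffun=> 0].
Hypothesis coordM : forall x y i, coord (x * y) i = coord x i * coord y i.

Let q := (#|F|.-1)%N.

Definition supp (x : R) : {set 'I_3} := [set i | coord x i != 0].

Lemma supp_eq0 x : (supp x == set0) = (x == 0).
Proof.
apply/eqP/eqP=> [x0 | ->]; last first.
  by apply/setP=> i; rewrite !inE coord0 ffunE eqxx.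
apply: (bij_inj coord_bij); apply/ffunP=> i; rewrite coord0 ffunE.
by have /setP/(_ i) := x0; rewrite !inE => /negbFE/eqP.
Qed.

Lemma mul_eq0_supp x y : (x * y == 0) = [disjoint supp x & supp y].
Proof.
rewrite -supp_eq0 -setI_eq0; congr (_ == _); apply/setP=> i.
by rewrite !inE coordM mulf_eq0 negb_or.
Qed.

Lemma zero_divisor_supp x : zero_divisor x = (supp x != setT).
Proof.
apply/existsP/idP=> [[y /andP[y0]]|].
  rewrite mul_eq0_supp -supp_eq0 in y0 *.
  by apply: contraTneq => ->; rewrite -setI_eq0 setTI.
rewrite eqEsubset subsetT /= => /subsetPn[i _ xi].
(* The idempotent supported at a missing coordinate [i] is a nonzero annihilator of [x]. *)
have [g gK Kg] := coord_bij; exists (g [ffun j => (j == i)%:R]).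
have sg : supp (g [ffun j => (j == i)%:R]) = [set i].
  apply/setP=> j; rewrite !inE Kg ffunE.
  by case: (j == i); rewrite ?oner_eq0 ?eqxx.
by rewrite mul_eq0_supp -supp_eq0 sg -card_gt0 cards1 disjoint_sym disjoints1.
Qed.

Lemma card_supp_eq (S : {set 'I_3}) : #|[set x | supp x == S]| = (q ^ #|S|)%N.
Proof.
have -> : q = #|predC1 (0 : F)| by rewrite cardC1.
(* [pffun_on] asks for support inside [S] and nonzero values on [S], which together mean support
   exactly [S]. *)
rewrite -(card_pffun_on 0) -(on_card_preimset (onW_bij _ coord_bij)).
apply: eq_card => x; rewrite !inE.
apply/eqP/pffun_onP => [xS|[/subsetP sS Sc]].
  rewrite -xS; split; first by apply/subsetP=> i; rewrite !inE.
  by move=> _ /imageP[i xi ->]; rewrite !inE in xi *.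
apply/setP=> i; rewrite inE; apply/idP/idP=> [/sS //|Si].
by have /Sc : coord x i \in image (coord x) (mem S) by apply: image_f.
Qed.

Lemma supp_vertex (v : zd_vertex R) :
  supp (val v) != set0 /\ supp (val v) != setT.
Proof. by have := valP v; rewrite zero_divisor_supp supp_eq0 => /andP. Qed.

Lemma card_supp_vertex_eq (S : {set 'I_3}) : S != set0 -> S != setT ->
  #|[set v : zd_vertex R | supp (val v) == S]| = (q ^ #|S|)%N.
Proof.
move=> S0 ST; rewrite -card_supp_eq -(card_imset _ val_inj).
apply: eq_card => x; rewrite [RHS]inE.
apply/imsetP/eqP => [[v] | xS]; first by rewrite inE => /eqP <- ->.
have xP : (x != 0) && zero_divisor x.
  by rewrite -supp_eq0 zero_divisor_supp xS S0.
by exists (exist _ x xP); rewrite ?inE /= ?xS.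
Qed.

(** Counted through the complement: removing zero and the [q ^ 3] elements of full support leaves
    [(q + 1) ^ 3 - 1 - q ^ 3]. *)
Lemma card_zd_vertex : #|zd_vertex R| = (3 * q + 3 * q ^ 2)%N.
Proof.
pose A := [set x : R | (x != 0) && zero_divisor x].
have -> : #|zd_vertex R| = #|A| by rewrite card_sig cardsE.
have := cardsC A.
have -> : ~: A = [set x | supp x == set0] :|: [set x | supp x == setT].
  by apply/setP=> x; rewrite !inE -supp_eq0 zero_divisor_supp negb_and !negbK.
rewrite cardsU !card_supp_eq cards0 cardsT card_ord.
have -> : [set x | supp x == set0] :&: [set x | supp x == setT] = set0.
  apply/setP=> x; rewrite !inE; apply/andP=> [[/eqP-> /eqP/setP/(_ ord0)]].
  by rewrite !inE.
rewrite cards0 (bij_eq_card coord_bij) card_ffun card_ord.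
have : #|F| = q.+1 by rewrite prednK // (cardD1 0).
move=> ->; lia.
Qed.

(** * The adjacency matrix and its characteristic polynomial *)

Variable C : numClosedFieldType.

Let T := zd_vertex R.
Let vsupp (v : 'I_#|T|) : {set 'I_3} := supp (val (enum_val v)).
Let U1 : 'M[C]_(#|T|, 3) :=
  \matrix_(v, i) (vsupp v == [set i])%:R.
Let U2 : 'M[C]_(#|T|, 3) :=
  \matrix_(v, i) (vsupp v == [set~ i])%:R.
(** Records adjacency to vertices of support [[set i]]. Adjacency to those of support [[set~ i]]
    means having support [[set i]], so that block is [U1^T]. *)
Let V1 : 'M[C]_(3, #|T|) :=
  \matrix_(i, v) (i \notin vsupp v)%:R.

Lemma set1_neq_setC1 (i j : 'I_3) : ([set i] == [set~ j]) = false.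
Proof.
apply/negbTE/negP=> /eqP /(congr1 (fun S : {set _} => #|S|)).
by rewrite cards1 cardsC1 card_ord.
Qed.

(** Each row of [row_mx U1 U2] has a single 1, at the support of its vertex, and so selects one row
    of [col_mx V1 U1^T]. *)
Lemma adjacency_mx_factor :
  adjacency_mx C (@zd_adj R) = row_mx U1 U2 *m col_mx V1 U1^T.
Proof.
apply/matrixP=> v w; rewrite mul_row_col !mxE /zd_adj mul_eq0_supp.
have [w0 wT] := supp_vertex (enum_val w).
have [v0 vT] := supp_vertex (enum_val v).
rewrite -/(vsupp v) in v0 vT *; rewrite -/(vsupp w) in w0 wT *.
have [[k vk]|[k vk]] := proper_set_ord3 _ v0 vT; rewrite vk.
  rewrite [X in _ = _ + X]big1 ?addr0 => [|i _]; last first.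
    by rewrite !mxE vk set1_neq_setC1 mul0r.
  rewrite (bigD1 k) //= big1 ?addr0 => [|i ik]; last first.
    by rewrite !mxE vk (inj_eq set1_inj) eq_sym (negbTE ik) mul0r.
  by rewrite !mxE vk eqxx mul1r disjoints1.
rewrite [X in _ = X + _]big1 ?add0r => [|i _]; last first.
  by rewrite !mxE vk eq_sym set1_neq_setC1 mul0r.
rewrite (bigD1 k) //= big1 ?addr0 => [|i ik]; last first.
  rewrite !mxE vk (inj_eq (@setC_inj _)) (inj_eq set1_inj) eq_sym.
  by rewrite (negbTE ik) mul0r.
(* Being disjoint from [[set~ k]] means lying in [[set k]], hence equality for a nonempty
   support. *)
rewrite !mxE vk eqxx mul1r disjoint_sym disjoints_subset setCK subset1.
by rewrite (negbTE w0) orbF.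
Qed.

(** Every entry of the 6 x 6 product is such a sum: only the [q ^ #|S|] vertices of support [S]
    contribute, all equally. *)
Lemma sum_supp (P : pred {set 'I_3}) (S : {set 'I_3}) :
  S != set0 -> S != setT ->
  \sum_(v < #|T|) (P (vsupp v))%:R * (vsupp v == S)%:R =
    (P S)%:R * (q ^ #|S|)%:R :> C.
Proof.
move=> S0 ST.
pose G (v : T) : C := (P (supp (val v)))%:R * (supp (val v) == S)%:R.
rewrite -(big_enum_val G) {}/G.
rewrite -card_supp_vertex_eq // -sum1_card natr_sum mulr_sumr.
rewrite big_mkcond [RHS]big_mkcond /=; apply: eq_bigr => v _.
by rewrite inE; case: eqP => [->|_]; rewrite ?mulr0.
Qed.

Lemma char_poly_zd :
  char_poly (adjacency_mx C (@zd_adj R)) * 'X^6 =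
  'X^(3 * q + 3 * q ^ 2) *
    (('X ^+ 2 + q%:R *: 'X - (q%:R ^+ 3)%:P) ^+ 2 *
     ('X ^+ 2 - (2 * q%:R) *: 'X - (q%:R ^+ 3)%:P)).
Proof.
rewrite adjacency_mx_factor mulrC -card_zd_vertex.
rewrite (@char_poly_mulmxC _ _ (3 + 3) (row_mx U1 U2)); congr (_ * _).
have s1 (i : 'I_3) : [set i] != set0 by rewrite -card_gt0 cards1.
have s1T (i : 'I_3) : [set i] != setT.
  by rewrite eqEcard cardsT cards1 card_ord andbF.
have s2 (i : 'I_3) : [set~ i] != set0 by rewrite -card_gt0 cardsC1 card_ord.
have s2T (i : 'I_3) : [set~ i] != setT.
  by rewrite eqEcard cardsT cardsC1 card_ord andbF.
rewrite mul_col_row.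
have -> : V1 *m U1 = const_mx q%:R - q%:R%:M.
  apply/matrixP=> i j; rewrite !mxE; under eq_bigr do rewrite !mxE.
  rewrite (sum_supp (fun S => i \notin S)) // cards1 expn1 inE -natrM.
  by case: eqP; rewrite ?mul0n ?mul1n ?subrr ?subr0.
have -> : V1 *m U2 = (q%:R ^+ 2)%:M.
  apply/matrixP=> i j; rewrite !mxE; under eq_bigr do rewrite !mxE.
  rewrite (sum_supp (fun S => i \notin S)) // cardsC1 card_ord !inE negbK.
  rewrite -natrX.
  by case: eqP; rewrite ?mul0r ?mul1r.
have -> : U1^T *m U1 = q%:R%:M.
  apply/matrixP=> i j; rewrite !mxE; under eq_bigr do rewrite !mxE.
  rewrite (sum_supp (fun S => S == [set i])) // cards1 expn1.
  by rewrite (inj_eq set1_inj) eq_sym; case: eqP; rewrite ?mul0r ?mul1r.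
have -> : U1^T *m U2 = 0.
  apply/matrixP=> i j; rewrite !mxE; under eq_bigr do rewrite !mxE.
  by rewrite (sum_supp (fun S => S == [set i])) // eq_sym set1_neq_setC1 mul0r.
rewrite char_poly_block_scalar.
set q' : C := q%:R.
rewrite [X in \det X](_ : _ =
  ('X ^+ 2 + q' *: 'X - (q' ^+ 3)%:P)%:M - const_mx (q' *: 'X)); last first.
  apply/matrixP=> i j; rewrite !mxE.
  rewrite -!mul_polyC !(polyCD, polyCN, polyCM, polyC_exp).
  by case: eqP => _; ring.
rewrite det_scalarBconst3 -!mul_polyC !(polyCD, polyCN, polyCM, polyC_exp).
by ring.
Qed.

End ProductOfThreeCopies.

(** * Coordinates over the prime field and the final spectrum *)

Lemma ring_isomorphic_Fp3_coord (p : nat) (R : finComNzRingType) :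
  prime p -> ring_isomorphic R ('Z_p * 'Z_p * 'Z_p)%type ->
  exists coord : R -> {ffun 'I_3 -> 'F_p},
    [/\ bijective coord, coord 0 = [ffun=> 0]
       & forall x y i, coord (x * y) i = coord x i * coord y i].
Proof.
move=> p_prime R_iso.
have {R_iso} [f [g fK gK]] : ring_isomorphic R ('F_p * 'F_p * 'F_p)%type.
  (* ['F_p] is ['Z_(pdiv p)], and [pdiv p = p] for a prime. *)
  by move: (pdiv p) (pdiv_id p_prime) => _ ->.
exists (fun x =>
  [ffun i : 'I_3 => [:: (f x).1.1; (f x).1.2; (f x).2]`_i : 'F_p]).
split.
- exists (fun h : {ffun 'I_3 -> 'F_p} =>
    g (h (inord 0), h (inord 1), h (inord 2))) => [x|h].
    rewrite !ffunE !inordK //=; apply: (canLR fK).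
    by case: (f x) => [[]].
  apply/ffunP=> i; rewrite ffunE gK /=.
  by case: i => [[|[|[|//]]] i3] /=; congr (h _);
    apply/val_inj; rewrite /= inordK.
- by apply/ffunP=> i; rewrite !ffunE rmorph0; case: i => [[|[|[|//]]] i3].
- by move=> x y i; rewrite !ffunE rmorphM; case: i => [[|[|[|//]]] i3].
Qed.

Theorem mainTheorem7 (C : numClosedFieldType) (p : nat) (R : finComNzRingType)
    (p_prime : prime p)
    (R_iso : ring_isomorphic R ('Z_p * 'Z_p * 'Z_p)%type) :
  let lambda1 : C :=
    (1 - p%:R + (p%:R - 1) * sqrtC (4 * p%:R - 3)) / 2 in
  let lambda2 : C :=
    (1 - p%:R - (p%:R - 1) * sqrtC (4 * p%:R - 3)) / 2 in
  let lambda3 : C := p%:R - 1 + sqrtC (p%:R - 2 * p%:R ^+ 2 + p%:R ^+ 3) in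
  let lambda4 : C := p%:R - 1 - sqrtC (p%:R - 2 * p%:R ^+ 2 + p%:R ^+ 3) in
  perm_eq (graph_spectrum C (@zd_adj R))
    (nseq 2 lambda1 ++ nseq 2 lambda2 ++ nseq 1 lambda3 ++ nseq 1 lambda4 ++
     nseq (3 * (p + 1) * (p - 2))%N 0).
Proof.
have [coord [cbij c0 cM]] := ring_isomorphic_Fp3_coord _ _ p_prime R_iso.
cbv zeta; set l1 : C := (X in nseq 2 X ++ nseq 2 _ ++ _).
set l2 : C := (X in _ ++ nseq 2 X ++ nseq 1 _ ++ _).
set l3 : C := (X in _ ++ nseq 1 X ++ nseq 1 _ ++ _).
set l4 : C := (X in _ ++ nseq 1 X ++ nseq (_ * _) _).
apply: perm_mx_spectrum.
have /mulIf := monic_neq0 (monicXn C 6); apply.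
rewrite (char_poly_zd _ _ _ cbij c0 cM) card_Fp //.
rewrite !big_cat !big_nseq !iter_mulr_1 subr0.
have p2 := prime_gt1 p_prime.
(* The exponent exceeds the multiplicity of 0 by six; since [p >= 2], the truncated [p - 2] is
   exact. *)
have -> : (3 * p.-1 + 3 * p.-1 ^ 2 = 3 * (p + 1) * (p - 2) + 6)%N by nia.
set q : C := p.-1%:R.
have pq : p%:R = q + 1 :> C by rewrite /q natr1 prednK // prime_gt0.
(* By Vieta's formulas, the two quadratic factors split once the sums and products of the claimed
   roots are known. *)
have S12 : l1 + l2 = - q by rewrite /l1 /l2 pq; field.
have P12 : l1 * l2 = - q ^+ 3.
  have := sqrtCK (4 * p%:R - 3 : C); rewrite /l1 /l2 pq.
  set s := sqrtC _ => ss.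
  (* Since [s ^+ 2 = 4 * q + 1], the cube can be expressed through [s], leaving an identity in [q]
     and [s] alone. *)
  have -> : q ^+ 3 = q ^+ 2 * (s ^+ 2 - 1) / 4 by rewrite ss; field.
  by field.
have S34 : l3 + l4 = 2 * q by rewrite /l3 /l4 pq; ring.
have P34 : l3 * l4 = - q ^+ 3.
  have := sqrtCK (p%:R - 2 * p%:R ^+ 2 + p%:R ^+ 3 : C); rewrite /l3 /l4 pq.
  set s := sqrtC _ => ss.
  (* The radicand is [p * (p - 1) ^ 2 = q ^ 3 + q ^ 2]. *)
  have -> : - q ^+ 3 = q ^+ 2 - s ^+ 2 by rewrite ss; ring.
  by ring.
have pairE (a b : C) :
  ('X - a%:P) * ('X - b%:P) = 'X ^+ 2 - (a + b) *: 'X + (a * b)%:P.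
  by rewrite -mul_polyC polyCD polyCM; ring.
have -> : 'X^2 + q *: 'X - (q ^+ 3)%:P = ('X - l1%:P) * ('X - l2%:P).
  by rewrite pairE S12 P12 scaleNr opprK polyCN.
have -> : 'X^2 - (2 * q) *: 'X - (q ^+ 3)%:P = ('X - l3%:P) * ('X - l4%:P).
  by rewrite pairE S34 P34 polyCN.
by rewrite exprD /=; ring.
Qed.
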